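(* Let $\Omega\subseteq\mathbb{H}$ be open and let $f:\Omega\to\mathbb{H}$ be S-derivable by the left at every point of $\Omega$. Then $f$ is Cullen-regular in $\Omega$; that is, for every $I\in\mathbb{H}$ with $I^2=-1$, the restriction of $f$ to $\Omega\cap(\mathbb{R}+I\mathbb{R})$, regarded as a function of $(t,r)$ via $q=t+rI$ with $t,r\in\mathbb{R}$, satisfies $$\frac{\partial f}{\partial t}+I\,\frac{\partial f}{\partial r}=0$$ at every point of $\Omega\cap(\mathbb{R}+I\mathbb{R})$.
   Context: $\mathbb{H}$ denotes the quaternions; write $q=t+xi+yj+zk$ with $t,x,y,z\in\mathbb{R}$. For $q\in\mathbb{H}\setminus\mathbb{R}$ write uniquely $q=t+r\iota$ with $t$ the real part, $r=\sqrt{x^2+y^2+z^2}>0$ and $\iota=\iota(q)=(xi+yj+zk)/r$, so $\iota^2=-1$. For $q\in\mathbb{H}\setminus\mathbb{R}$ and $h\in\mathbb{H}$ set $$h_\parallel:=\frac{h-\iota h\iota}{2},\qquad h_\perp:=\frac{h+\iota h\iota}{2},\qquad \iota=\iota(q).$$ S-derivable at a point: let $f$ be continuous and real differentiable at $q$. If $q\in\mathbb{R}$, $f$ is S-derivable by the left at $q$ if there is $A\in\mathbb{H}$ with $\lim_{h\to0}h^{-1}(f(q+h)-f(q)-hA)=0$. If $q\in\mathbb{H}\setminus\mathbb{R}$, $f$ is S-derivable by the left at $q$ if there are $B,C\in\mathbb{H}$ with $\lim_{h\to0}h^{-1}(f(q+h)-f(q)-h_\parallel B-h_\perp C)=0$.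 Here $h\in\mathbb{H}\setminus\{0\}$. *)

(* Defs.v *)
From HB Require Import structures.
From mathcomp Require Import all_boot all_order all_algebra.
From mathcomp Require Import ring.
From mathcomp Require Import boolp classical_sets functions reals topology.
From mathcomp Require Import normedtype derive.

Set Implicit Arguments.
Unset Strict Implicit.
Unset Printing Implicit Defensive.

Import Order.TTheory GRing.Theory Num.Theory.
Import numFieldNormedType.Exports.

Local Open Scope classical_set_scope.
Local Open Scope ring_scope.

(* The quaternion t + xi + yj + zk is the row vector (t, x, y, z). The norm   *)
(* inherited from 'rV_4 is the sup norm; it is equivalent to the Euclidean    *)
(* one, so limits, open sets and real differentiability are the usual ones.   *)
Definition quat (R : realType) : Type := 'rV[R]_4.

HB.instance Definition _ (R : realType) :=
  NormedModule.copy (quat R) 'rV[R]_4.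

Section Quaternions.
Context {R : realType}.
Implicit Types p q h : quat R.

Definition mkquat (t x y z : R) : quat R := \row_(i < 4) [:: t; x; y; z]`_i.

Definition qt (q : quat R) : R := (q : 'rV[R]_4) 0 0.
Definition qx (q : quat R) : R := (q : 'rV[R]_4) 0 1.
Definition qy (q : quat R) : R := (q : 'rV[R]_4) 0 2%:R.
Definition qz (q : quat R) : R := (q : 'rV[R]_4) 0 3%:R.

Lemma quatP p q :
  qt p = qt q -> qx p = qx q -> qy p = qy q -> qz p = qz q -> p = q.
Proof.
move=> et ex ey ez; apply/matrixP => i j; rewrite (ord1 i).
by case: j => [[|[|[|[|//]]]] lt_j]; [move: et|move: ex|move: ey|move: ez];
   congr (_ = _); congr (fun_of_matrix _ _ _); apply/val_inj.
Qed.

Lemma qt_mk t x y z : qt (mkquat t x y z) = t. Proof. by rewrite /qt mxE. Qed.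
Lemma qx_mk t x y z : qx (mkquat t x y z) = x. Proof. by rewrite /qx mxE. Qed.
Lemma qy_mk t x y z : qy (mkquat t x y z) = y. Proof. by rewrite /qy mxE. Qed.
Lemma qz_mk t x y z : qz (mkquat t x y z) = z. Proof. by rewrite /qz mxE. Qed.
Lemma qt_add p q : qt (p + q) = qt p + qt q. Proof. by rewrite /qt mxE. Qed.
Lemma qx_add p q : qx (p + q) = qx p + qx q. Proof. by rewrite /qx mxE. Qed.
Lemma qy_add p q : qy (p + q) = qy p + qy q. Proof. by rewrite /qy mxE. Qed.
Lemma qz_add p q : qz (p + q) = qz p + qz q. Proof. by rewrite /qz mxE. Qed.
Lemma qt_scale a q : qt (a *: q) = a * qt q. Proof. by rewrite /qt mxE. Qed.
Lemma qx_scale a q : qx (a *: q) = a * qx q. Proof. by rewrite /qx mxE. Qed.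
Lemma qy_scale a q : qy (a *: q) = a * qy q. Proof. by rewrite /qy mxE. Qed.
Lemma qz_scale a q : qz (a *: q) = a * qz q. Proof. by rewrite /qz mxE. Qed.
Lemma qt_zero : qt 0 = 0. Proof. by rewrite /qt mxE. Qed.
Lemma qx_zero : qx 0 = 0. Proof. by rewrite /qx mxE. Qed.
Lemma qy_zero : qy 0 = 0. Proof. by rewrite /qy mxE. Qed.
Lemma qz_zero : qz 0 = 0. Proof. by rewrite /qz mxE. Qed.

Definition quatE := (qt_mk, qx_mk, qy_mk, qz_mk, qt_add, qx_add, qy_add,
  qz_add, qt_scale, qx_scale, qy_scale, qz_scale,
  qt_zero, qx_zero, qy_zero, qz_zero).

Definition qone : quat R := mkquat 1 0 0 0.

Definition qmul p q : quat R :=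
  mkquat (qt p * qt q - qx p * qx q - qy p * qy q - qz p * qz q)
         (qt p * qx q + qx p * qt q + qy p * qz q - qz p * qy q)
         (qt p * qy q - qx p * qz q + qy p * qt q + qz p * qx q)
         (qt p * qz q + qx p * qy q - qy p * qx q + qz p * qt q).

Definition qnormsq q : R := qt q ^+ 2 + qx q ^+ 2 + qy q ^+ 2 + qz q ^+ 2.

Definition qinv q : quat R :=
  (qnormsq q)^-1 *: mkquat (qt q) (- qx q) (- qy q) (- qz q).

Fact qmulA : associative qmul.
Proof. by move=> p q h; apply: quatP; rewrite /qmul !quatE; ring. Qed.

Fact qmul1q : left_id qone qmul.
Proof. by move=> q; apply: quatP; rewrite /qmul /qone !quatE; ring. Qed.

Fact qmulq1 : right_id qone qmul.
Proof. by move=> q; apply: quatP; rewrite /qmul /qone !quatE; ring. Qed.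

Fact qmulDl : left_distributive qmul +%R.
Proof. by move=> p q h; apply: quatP; rewrite /qmul !quatE; ring. Qed.

Fact qmulDr : right_distributive qmul +%R.
Proof. by move=> p q h; apply: quatP; rewrite /qmul !quatE; ring. Qed.

Fact qone_neq0 : qone != 0.
Proof.
apply/eqP => /(congr1 qt); rewrite /qone !quatE => /eqP.
by rewrite oner_eq0.
Qed.

HB.instance Definition _ := GRing.Zmodule_isNzRing.Build (quat R)
  qmulA qmul1q qmulq1 qmulDl qmulDr qone_neq0.

Lemma qmulE p q : p * q = qmul p q. Proof. by []. Qed.
Lemma qoneE : 1 = qone. Proof. by []. Qed.

Fact qscaleAl (a : R) p q : a *: (p * q) = a *: p * q.
Proof. by apply: quatP; rewrite !qmulE /qmul !quatE; ring. Qed.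

HB.instance Definition _ := GRing.Lmodule_isLalgebra.Build R (quat R) qscaleAl.

Fact qscaleAr (a : R) p q : a *: (p * q) = p * (a *: q).
Proof. by apply: quatP; rewrite !qmulE /qmul !quatE; ring. Qed.

HB.instance Definition _ := GRing.Lalgebra_isAlgebra.Build R (quat R) qscaleAr.

Lemma qnormsq_eq0 q : (qnormsq q == 0) = (q == 0).
Proof.
apply/eqP/eqP => [|->]; last by rewrite /qnormsq !quatE; ring.
move/eqP; rewrite /qnormsq !paddr_eq0 ?addr_ge0 ?sqr_ge0// !sqrf_eq0.
move=> /andP[/andP[/andP[/eqP t0 /eqP x0] /eqP y0] /eqP z0].
by apply: quatP; rewrite !quatE.
Qed.

Definition qunit : {pred quat R} := [pred q | q != 0].

Fact qmulVq : {in qunit, left_inverse 1 qinv *%R}.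
Proof.
move=> q; rewrite inE -qnormsq_eq0 => q0.
rewrite qmulE qoneE /qinv /qmul /qone; apply: quatP; rewrite !quatE.
all: by move: q0; rewrite /qnormsq => q0; field.
Qed.

Fact qmulqV : {in qunit, right_inverse 1 qinv *%R}.
Proof.
move=> q; rewrite inE -qnormsq_eq0 => q0.
rewrite qmulE qoneE /qinv /qmul /qone; apply: quatP; rewrite !quatE.
all: by move: q0; rewrite /qnormsq => q0; field.
Qed.

Fact qunitP p q : q * p = 1 /\ p * q = 1 -> qunit p.
Proof.
move=> [qp1 _]; apply/eqP => p0; move: qp1; rewrite p0 mulr0 => /esym/eqP.
by rewrite oner_eq0.
Qed.

Fact qinv_out : {in [predC qunit], qinv =1 id}.
Proof.
by move=> q; rewrite !inE negbK => /eqP ->; apply: quatP;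
   rewrite /qinv !quatE; ring.
Qed.

HB.instance Definition _ := GRing.NzRing_hasMulInverse.Build (quat R)
  qmulVq qmulqV qunitP qinv_out.

Definition qim q : quat R := mkquat 0 (qx q) (qy q) (qz q).

Definition qreal : set (quat R) := [set q | exists a : R, q = a%:A].

(* Only meaningful for q \notin qreal. *)
Definition qiota q : quat R :=
  (Num.sqrt (qx q ^+ 2 + qy q ^+ 2 + qz q ^+ 2))^-1 *: qim q.

Definition qpar q h : quat R := 2^-1 *: (h - qiota q * h * qiota q).
Definition qperp q h : quat R := 2^-1 *: (h + qiota q * h * qiota q).

(* Continuity at q, although implied by differentiability, is kept as in the  *)
(* usual definition. The punctured filter 0^' accounts for h != 0.            *)
Definition S_derivable_left (f : quat R -> quat R) (q : quat R) : Prop :=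
  [/\ {for q, continuous f}, differentiable f q,
      qreal q -> exists A : quat R,
        h^-1 * (f (q + h) - f q - h * A) @[h --> (0 : quat R)^'] -->
          (0 : quat R)
    & ~ qreal q -> exists B C : quat R,
        h^-1 * (f (q + h) - f q - qpar q h * B - qperp q h * C)
          @[h --> (0 : quat R)^'] --> (0 : quat R)].

Definition slice (I : quat R) (f : quat R -> quat R) (t r : R) : quat R :=
  f (t%:A + r *: I).

(* The vanishing equation includes the existence of both partial derivatives, *)
(* as derive1 is a total operator.                                            *)
Definition Cullen_regular (Omega : set (quat R)) (f : quat R -> quat R) :
    Prop :=
  forall I : quat R, I ^+ 2 = -1 ->
  forall t r : R, Omega (t%:A + r *: I) ->
  [/\ derivable (fun s : R => slice I f s r) t 1,
      derivable (fun s : R => slice I f t s) r 1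
    & derive1 (fun s : R => slice I f s r) t
        + I * derive1 (fun s : R => slice I f t s) r = 0].

End Quaternions.

(* Main.v *)
Require Import Defs.
From mathcomp Require Import all_boot all_order all_algebra.
From mathcomp Require Import ring lra.
From mathcomp Require Import boolp classical_sets functions reals topology.
From mathcomp Require Import normedtype derive.

(** At a point q = t + rI, increments h in the slice R + IR commute with
    iota(q) = +-I (if r <> 0), so h_par = h and h_perp = 0. So f has at q a left
    slice derivative D: along h = s the quotient gives df/dt = D, and along
    h = sI it gives df/dr = I D, whence df/dt + I df/dr = D + I^2 D = 0. *)

Import Order.TTheory GRing.Theory Num.Theory.
Import numFieldNormedType.Exports.

Local Open Scope classical_set_scope.
Local Open Scope ring_scope.

Section SliceDerivative.
Context {R : realType}.
Implicit Types (p q h v I D : quat R) (f : quat R -> quat R) (s t r : R).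

(** For fixed [p] the coefficients are the coordinates of [q] and the quaternions are constant, so
    continuity of left multiplication reduces to that of the coordinates. *)
Lemma quat_mul_coord p q :
  p * q = qt q *: p + qx q *: (p * mkquat 0 1 0 0)
    + qy q *: (p * mkquat 0 0 1 0) + qz q *: (p * mkquat 0 0 0 1).
Proof. by apply: quatP; rewrite !qmulE /qmul !quatE; ring. Qed.

Lemma continuous_qmull p : continuous (fun q => p * q).
Proof.
move=> q; rewrite (funext (quat_mul_coord p)).
rewrite /continuous_at.
have cZ (c : quat R -> R) (a : quat R) :
    continuous c -> c x *: a @[x --> q] --> c q *: a.
  by move=> cc; exact: (@cvgZr_tmp _ _ _ (nbhs q) _ _ _ _ (cc q)).
have cD := @cvgD _ (quat R) _ (nbhs q) _.
by apply: (cD); [apply: (cD); [apply: (cD)|]|];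
  apply: cZ; exact: coord_continuous.
Qed.

Lemma quat_unit q : (q \is a GRing.unit) = (q != 0).
Proof. by []. Qed.

(** Restricts a punctured quaternionic limit to the real line through [v]; injectivity of [s *: v]
    in [s] keeps the increments nonzero. *)
Lemma cvg_scale_dnbhs0 v : v != 0 -> (s *: v) @[s --> (0 : R)^'] --> 0^'.
Proof.
move=> v0; rewrite -[X in _ --> X^'](scale0r v).
apply: (@continuous_injective_withinNx _ _ (fun s : R => s *: v)).
  exact: (cvgZr_tmp (@cvg_id _ (nbhs (0 : R)))).
by move=> s /eqP; rewrite scale0r scaler_eq0 (negPf v0) orbF => /eqP.
Qed.

(** [derivable] takes the increment [s *: 1] and [derive1] takes [s]; for real [s] they agree. *)
Lemma derive1_cvg (g : R -> quat R) r D :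
  s^-1 *: (g (s + r) - g r) @[s --> (0 : R)^'] --> D ->
  derivable g r 1 /\ derive1 g r = D.
Proof.
move=> gD; split; last exact: cvg_lim.
apply/cvg_ex; exists D; apply: cvg_trans gD.
by apply: near_eq_cvg; apply: nearW => s /=; rewrite [s *: 1]mulr1.
Qed.

(** Multiply the hypothesis on the left by [v]: real scalars are central, so [v * (s *: v)^-1] is
    the real number [s^-1]. *)
Lemma cvg_directional f q v D : v != 0 ->
  (s *: v)^-1 * (f (q + s *: v) - f q - s *: v * D) @[s --> (0 : R)^'] -->
    (0 : quat R) ->
  s^-1 *: (f (q + s *: v) - f q) @[s --> (0 : R)^'] --> v * D.
Proof.
move=> v0 fD; rewrite -[v * D]add0r -[X in X + _](mulr0 v).
have lim : v * ((s *: v)^-1 * (f (q + s *: v) - f q - s *: v * D)) + v * D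
    @[s --> (0 : R)^'] --> v * 0 + v * D.
  apply: cvgD; last exact: cvg_cst.
  by apply: continuous_cvg fD; exact: continuous_qmull.
apply: cvg_trans lim; apply: near_eq_cvg.
near=> s.
have s0 : s != 0 by near: s; exact: nbhs_dnbhs_neq.
have vs : v * (s *: v)^-1 = s^-1 *: 1.
  by rewrite -(@divrr _ (s *: v)) ?quat_unit ?scaler_eq0 ?negb_or ?s0//
    -[s *: v / _]scalerAl scalerA mulVf// scale1r.
rewrite mulrA vs -scalerAl mul1r scalerBr -scalerAl scalerA mulVf// scale1r.
by rewrite subrK.
Unshelve. all: by end_near. Qed.

Lemma quat_sqrN1 I : I ^+ 2 = -1 ->
  qt I = 0 /\ qx I ^+ 2 + qy I ^+ 2 + qz I ^+ 2 = 1.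
Proof.
rewrite expr2 -[-1]scaleN1r => I2.
have et := congr1 qt I2; have ex := congr1 qx I2.
have ey := congr1 qy I2; have ez := congr1 qz I2.
move: et ex ey ez; rewrite !qmulE qoneE /qmul /qone !quatE => et ex ey ez.
have t0 : qt I = 0.
  have tx : qt I * qx I = 0 by lra.
  have ty : qt I * qy I = 0 by lra.
  have tz : qt I * qz I = 0 by lra.
  have tt : qt I ^+ 2 = qx I ^+ 2 + qy I ^+ 2 + qz I ^+ 2 - 1 by lra.
  (* The imaginary coordinates of [I ^+ 2 = -1] make [qt I] annihilate [qx I], [qy I] and [qz I];
     the second factor is positive. *)
  have : qt I * (qt I ^+ 2 + 1) = 0.
    rewrite tt subrK !mulrDr !expr2 !mulrA tx ty tz; ring.
  move/eqP; rewrite mulf_eq0 => /orP[/eqP//|/eqP]; nra.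
by split=> //; move: et; rewrite t0; nra.
Qed.

(** The scalar is the sign of [r], since the imaginary part [r *: I] has Euclidean norm [|r|]. At
    [r = 0] both sides vanish because [0^-1 = 0]. *)
Lemma qiota_slice t r I : I ^+ 2 = -1 ->
  qiota (t%:A + r *: I) = (`|r|^-1 * r) *: I.
Proof.
move=> /quat_sqrN1[t0 n1].
rewrite /qiota -scalerA; congr (_ *: _); last first.
  by apply: quatP; rewrite /qim qoneE /qone !quatE ?t0; ring.
rewrite qoneE /qone !quatE !mulr0 !add0r !exprMn -!mulrDr n1 mulr1.
by rewrite sqrtr_sqr.
Qed.

Lemma slice_nonreal t r I : I ^+ 2 = -1 -> r != 0 -> ~ qreal (t%:A + r *: I).
Proof.
move=> /quat_sqrN1[_ n1] r0 [a qa].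
have im0 (c : quat R -> R) : c (t%:A + r *: I) = r * c I -> c a%:A = 0 ->
    c I = 0.
  move=> cE ca0; apply/eqP; have := ca0.
  by rewrite -qa cE => /eqP; rewrite mulf_eq0 (negPf r0).
have x0 : qx I = 0 by apply: im0; rewrite qoneE /qone !quatE; ring.
have y0 : qy I = 0 by apply: im0; rewrite qoneE /qone !quatE; ring.
have z0 : qz I = 0 by apply: im0; rewrite qoneE /qone !quatE; ring.
by move: n1; rewrite x0 y0 z0; lra.
Qed.

(** The sign of [r] occurs twice and cancels, leaving [I * h * I = h * I ^+ 2]. *)
Lemma qiota_sandwich t r I h : I ^+ 2 = -1 -> r != 0 -> GRing.comm h I ->
  qiota (t%:A + r *: I) * h * qiota (t%:A + r *: I) = - h.
Proof.
move=> I2 r0 hI; rewrite qiota_slice// -!scalerAl -scalerAr scalerA.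
rewrite -hI -[h * I * I]mulrA -[I * I]expr2 I2 mulrN1.
rewrite (_ : _ * _ = 1) ?scale1r//.
by rewrite -expr2 exprMn exprVn real_normK ?num_real// mulVf// sqrf_eq0.
Qed.

(** One [D] serves every direction commuting with [I]: it is [A] at a real point and [B]
    elsewhere. *)
Lemma S_derivable_slice f t r I : I ^+ 2 = -1 ->
  S_derivable_left f (t%:A + r *: I) ->
  exists D, forall v, v != 0 -> GRing.comm v I ->
    s^-1 *: (f (t%:A + r *: I + s *: v) - f (t%:A + r *: I))
      @[s --> (0 : R)^'] --> v * D.
Proof.
move=> I2 [_ _ freal fnonreal]; have [r0|r0] := eqVneq r 0.
  have [|D fD] := freal; first by exists t; rewrite r0 scale0r addr0.
  exists D => v v0 _; apply: cvg_directional => //.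
  exact: (cvg_comp _ _ (cvg_scale_dnbhs0 _ v0) fD).
have [B [C fBC]] := fnonreal (slice_nonreal t _ _ I2 r0).
exists B => v v0 vI; apply: cvg_directional => //.
apply: cvg_trans (cvg_comp _ _ (cvg_scale_dnbhs0 _ v0) fBC).
apply: near_eq_cvg; apply: nearW => s /=.
have svI : GRing.comm (s *: v) I by rewrite /GRing.comm -scalerAl vI scalerAr.
(* The term in [C] vanishes, and the parallel part becomes half of [s *: v + s *: v]. *)
rewrite /qpar /qperp qiota_sandwich// opprK addrN scaler0 mul0r subr0.
rewrite -[s *: v + _]mulr2n -[s *: v *+ 2]scaler_nat.
by rewrite scalerK ?unitfE ?pnatr_eq0.
Qed.

End SliceDerivative.

(* Only the values of f on the open set Omega matter. *)
Theorem mainTheorem3 (R : realType) (Omega : set (quat R))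
    (f : quat R -> quat R) (Omega_open : open Omega)
    (f_derivable : forall q : quat R, Omega q -> S_derivable_left f q) :
  Cullen_regular Omega f.
Proof.
move=> I I2 t r /f_derivable /(S_derivable_slice _ _ _ _ I2)[D fD].
have I0 : I != 0.
  apply/eqP => I0; move: I2; rewrite I0 expr0n /= => /esym/eqP.
  by rewrite oppr_eq0 oner_eq0.
have [dt ->] : derivable (slice I f ^~ r) t 1 /\
    derive1 (slice I f ^~ r) t = D.
  apply: derive1_cvg; rewrite -(mul1r D).
  (* Varying [t] moves the point in direction [1]; varying [r] below moves it in direction [I]. *)
  apply: cvg_trans (fD 1 (oner_neq0 _) (commr_sym (commr1 I))).
  apply: near_eq_cvg; apply: nearW => s /=.
  have e : (s + t)%:A + r *: I = t%:A + r *: I + s%:A.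
    by rewrite scalerDl -addrA addrC.
  by rewrite /slice e.
have [dr ->] : derivable (slice I f t) r 1 /\ derive1 (slice I f t) r = I * D.
  apply: derive1_cvg; apply: cvg_trans (fD I I0 erefl).
  apply: near_eq_cvg; apply: nearW => s /=.
  by rewrite /slice scalerDl (addrC (s *: I)) addrA.
split; [exact: dt|exact: dr|].
rewrite mulrA -[I * I]expr2 I2 mulN1r; exact: subrr.
Qed.
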